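(* Let $\mathcal D$ be a set of datasets equipped with a neighboring relation $\sim$, let $\mathcal A:\mathcal D\to\mathbb R^k$ be a randomized algorithm, and let $\varepsilon>0$. Define the Laplace mechanism $\mathcal M_L(D)=\mathcal A(D)+(Y_1,\ldots,Y_k)$, where $Y_1,\dots,Y_k$ are i.i.d. random variables drawn from $\mathrm{Lap}(CGS_{\mathcal A}/\varepsilon)$ independently of $\mathcal A$. Then $\mathcal M_L$ is $\varepsilon$-differentially private, i.e. for all $D_1\sim D_2$ and every (measurable) set $\mathcal S\subseteq\mathbb R^k$, $\Pr[\mathcal M_L(D_1)\in\mathcal S]\le e^{\varepsilon}\Pr[\mathcal M_L(D_2)\in\mathcal S]$.
   Context: $\mathrm{Lap}(\lambda)$ is the Laplace distribution with density $h(z)=\frac{1}{2\lambda}\exp(-|z|/\lambda)$. For random variables $Z,Z'$, a coupling is a joint random variable $(Z_c,Z'_c)$ whose marginals are distributed as $Z$ and $Z'$ respectively; $\mathsf{Couple}(Z,Z')$ denotes the set of all couplings. For a randomized algorithm $\mathcal A$, $\mathcal A(D)$ denotes the random output on input $D$. The coupled global sensitivity of $\mathcal A$ is $CGS_{\mathcal A}:=\max_{D_1\sim D_2}\ \min_{C\in\mathsf{Couple}(\mathcal A(D_1),\mathcal A(D_2))}\ \max_{(z,z')\in C}\|z-z'\|_1$, where the inner maximum is over pairs in the support of $C$. *)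

(* Defs.v *)
From HB Require Import structures.
From mathcomp Require Import all_boot all_order all_algebra.
From mathcomp Require Import all_classical all_reals all_analysis.

Set Implicit Arguments.
Unset Strict Implicit.
Unset Printing Implicit Defensive.

Import Order.TTheory GRing.Theory Num.Theory.
Import numFieldNormedType.Exports.

Local Open Scope classical_set_scope.
Local Open Scope ring_scope.

Section laplace_distribution.
Context {R : realType}.
Local Open Scope ereal_scope.

Definition laplace_pdf (b x : R) : R := ((2 * b)^-1 * expR (- (`|x| / b)))%R.

(* The density is meaningless at scale b = 0; Lap(0) is read as its weak limit,
   the point mass at 0. *)
Definition laplace_prob (b : R) : set R -> \bar R :=
  if b == 0%R then \d_(0%R : R)
  else fun V => \int[lebesgue_measure]_(x in V) (laplace_pdf b x)%:E.

End laplace_distribution.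

Section coupled_global_sensitivity.
Context {R : realType} {k : nat}.
Local Open Scope ereal_scope.

Definition dist1 (z z' : k.-tuple R) : R :=
  (\sum_(i < k) `|tnth z i - tnth z' i|)%R.

(* The coupling is identified with the joint law of (Z_c, Z'_c). *)
Definition couplings {d d' : measure_display}
    {Omega : measurableType d} {Omega' : measurableType d'}
    {P : probability Omega R} {P' : probability Omega' R}
    (Z : {RV P >-> k.-tuple R}) (Z' : {RV P' >-> k.-tuple R}) :
    set (probability (k.-tuple R * k.-tuple R)%type R) :=
  [set C | forall B : set (k.-tuple R), measurable B ->
     C (fst @^-1` B) = distribution P Z B /\
     C (snd @^-1` B) = distribution P' Z' B].

(* Topological support in R^k x R^k: the points all of whose neighbourhoods
   have positive probability. *)
Definition coupling_support (C : probability (k.-tuple R * k.-tuple R)%type R) :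
    set (k.-tuple R * k.-tuple R) :=
  [set z | forall e : R, (0 < e)%R ->
     0 < C [set w | (dist1 w.1 z.1 < e)%R /\ (dist1 w.2 z.2 < e)%R]].

Definition coupled_global_sensitivity {T : Type} (nbr : T -> T -> Prop)
    {d : T -> measure_display} {Omega : forall D, measurableType (d D)}
    {P : forall D, probability (Omega D) R}
    (A : forall D, {RV (P D) >-> k.-tuple R}) : \bar R :=
  ereal_sup [set s | exists D1 D2, nbr D1 D2 /\
    s = ereal_inf [set ereal_sup [set (dist1 z.1 z.2)%:E | z in coupling_support C]
                  | C in couplings (A D1) (A D2)]].

End coupled_global_sensitivity.

Section laplace_mechanism.
Context {R : realType} {k : nat} {d : measure_display}
  {Omega : measurableType d} {P : probability Omega R}.
Local Open Scope ereal_scope.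

(* Y_1, ..., Y_k are i.i.d. with law Lap(b). Taking some B i to be setT gives
   the product rule for every subfamily. *)
Definition iid_laplace (b : R) (Y : 'I_k -> {RV P >-> R}) : Prop :=
  (forall i (B : set R), measurable B ->
     distribution P (Y i) B = laplace_prob b B) /\
  (forall B : 'I_k -> set R, (forall i, measurable (B i)) ->
     P (\bigcap_i (Y i @^-1` B i)) = \prod_(i < k) P (Y i @^-1` B i)).

Definition independent_of (Y : 'I_k -> {RV P >-> R})
    (Z : {RV P >-> k.-tuple R}) : Prop :=
  forall B S : set (k.-tuple R), measurable B -> measurable S ->
    P ((fun w => [tuple Y i w | i < k]) @^-1` B `&` Z @^-1` S) =
    P ((fun w => [tuple Y i w | i < k]) @^-1` B) * P (Z @^-1` S).

Definition add_noise (Z : {RV P >-> k.-tuple R}) (Y : 'I_k -> {RV P >-> R}) :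
    Omega -> k.-tuple R :=
  fun w => [tuple (tnth (Z w) i + Y i w)%R | i < k].

End laplace_mechanism.

Definition differentially_private {R : realType} {k : nat} {T : Type}
    (nbr : T -> T -> Prop) (eps : R)
    {d : T -> measure_display} {Omega : forall D, measurableType (d D)}
    (P : forall D, probability (Omega D) R)
    (M : forall D, Omega D -> k.-tuple R) : Prop :=
  forall D1 D2, nbr D1 D2 -> forall S : set (k.-tuple R), measurable S ->
    (P D1 (M D1 @^-1` S) <= (expR eps)%:E * P D2 (M D2 @^-1` S))%E.

(* Main.v *)
(** For a measurable [S], independence gives
    [Pr[M(D) \in S] = \int f d(law of A(D))] with [f z := Pr[z + Y \in S]].
    Shifting one coordinate of the noise by [t] changes probabilities by a
    factor at most [exp (|t| / b)], hence [f z <= exp (|z - z'|_1 / b) * f z'].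
    Integrating this bound against a coupling whose support lies within
    l1-distance [CGS + e] of the diagonal, and letting [e] tend to [0], gives
    the claim when [CGS > 0]: the infimum over couplings need not be attained.
    When [CGS = 0] the noise vanishes almost surely, and couplings arbitrarily
    close to the diagonal force the laws of [A(D1)] and [A(D2)] to agree on
    closed boxes, hence to be equal. *)
Require Import Defs.
From HB Require Import structures.
From mathcomp Require Import all_boot all_order all_algebra.
From mathcomp Require Import all_classical all_reals all_analysis.
From mathcomp Require Import measurable_realfun.
From mathcomp Require Import ring lra.

Import Order.TTheory GRing.Theory Num.Theory.
Import numFieldNormedType.Exports.

Local Open Scope classical_set_scope.
Local Open Scope ring_scope.

(** * Closed upper boxes determine finite measures *)

Section upper_box.
Context {R : realType} {k : nat}.
Implicit Types (a : 'I_k -> \bar R) (S : set (k.-tuple R)).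

Definition upper_ray (r : \bar R) : set R := [set x | (r <= x%:E)%E].

(* [a i = -oo] leaves coordinate [i] unconstrained, so that these boxes include
   the whole space and the preimages of rays under each coordinate. *)
Definition upper_box a : set (k.-tuple R) :=
  [set z | forall i, upper_ray (a i) (tnth z i)].

Lemma upper_rayNy : upper_ray -oo%E = setT.
Proof. by apply/seteqP; split => x //= _; rewrite /upper_ray/= leNye. Qed.

Lemma measurable_upper_ray (r : \bar R) : measurable (upper_ray r).
Proof.
case: r => [r| |].
- rewrite (_ : upper_ray _ = `[r, +oo[%classic)//.
  by apply/seteqP; split => x; rewrite /upper_ray /= lee_fin in_itv/= andbT.
- rewrite (_ : upper_ray _ = set0)//.
  by apply/seteqP; split => x.
- by rewrite upper_rayNy.
Qed.

Lemma upper_boxE a :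
  upper_box a = \bigcap_(i in setT) ((fun z : k.-tuple R => tnth z i) @^-1` upper_ray (a i)).
Proof. by apply/seteqP; split => z h i => [_|]; exact: h. Qed.

Lemma measurable_upper_box a : measurable (upper_box a).
Proof.
rewrite upper_boxE; apply: fin_bigcap_measurable => // i _.
rewrite -[X in measurable X]setTI; apply: measurable_tnth => //.
exact: measurable_upper_ray.
Qed.

Lemma upper_boxI a b :
  upper_box a `&` upper_box b = upper_box (fun i => Order.max (a i) (b i)).
Proof.
apply/seteqP; split => z /=.
  by move=> [za zb] i; rewrite /upper_ray/= ge_max; apply/andP; split; [exact: za|exact: zb].
by move=> h; split => i; have := h i; rewrite /upper_ray/= ge_max => /andP[].
Qed.

Lemma upper_boxT : upper_box (fun=> -oo%E) = setT.
Proof. by apply/seteqP; split => z // _ i; rewrite upper_rayNy. Qed.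

(** Pi-lambda argument: upper boxes are stable under intersection, include the whole space and
    generate the product sigma-algebra. *)
Lemma upper_box_unique (m1 m2 : {measure set (k.-tuple R) -> \bar R}) :
  (m1 setT < +oo)%E ->
  (forall a, m1 (upper_box a) = m2 (upper_box a)) ->
  forall S, measurable S -> m1 S = m2 S.
Proof.
move=> m1oo m12; pose G := range upper_box.
apply: (measure_unique G (fun=> setT)) => //.
- rewrite eqEsubset; split; last first.
    apply: smallest_sub; first exact: sigma_algebra_measurable.
    by move=> _ [a _ <-]; exact: measurable_upper_box.
  apply: smallest_sub; first exact: smallest_sigma_algebra.
  rewrite -bigcup_seq => B [i _] [A mA <-].
  (* The sets of reals whose preimage under coordinate [i] lies in [<<s G>>] form a sigma-algebra,
     so it is enough to treat closed rays, whose preimages are boxes constraining only that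
     coordinate. *)
  suff : @measurable _ R `<=` image_set_system setT (fun z : k.-tuple R => tnth z i) <<s G >>.
    by apply.
  rewrite [X in X `<=` _](RGenCInfty.measurableE R).
  apply: smallest_sub.
    by apply: sigma_algebra_image; exact: smallest_sigma_algebra.
  move=> _ [x ->]; rewrite /image_set_system/= setTI.
  apply: sub_sigma_algebra; exists (fun j => if j == i then x%:E else -oo%E) => //.
  apply/seteqP; split => z /=.
    by move=> /(_ i); rewrite eqxx /upper_ray/= lee_fin in_itv/= andbT.
  rewrite in_itv/= andbT => xz j; rewrite /upper_ray/=.
  by case: eqP => [->|_]; rewrite ?lee_fin ?leNye.
- by move=> _ _ [a _ <-] [b _ <-]; rewrite upper_boxI; eexists.
- by move=> _; exists (fun=> -oo%E) => //; exact: upper_boxT.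
- by rewrite bigcup_const.
- by move=> _ [a _ <-].
Qed.

End upper_box.

(** * Shifts of the Laplace law on the real line *)

Section laplace_shift.
Context {R : realType}.
Local Open Scope ereal_scope.

(** Translation preserves the length of half-open intervals, and these lengths characterize Lebesgue
    measure. *)
Lemma lebesgue_measure_shift (t : R) (A : set R) : measurable A ->
  pushforward lebesgue_measure (fun x : measurableTypeR R => (x + t)%R : measurableTypeR R) A =
  lebesgue_measure A.
Proof.
move=> mA.
have mt : measurable_fun setT (fun x : measurableTypeR R => (x + t)%R : measurableTypeR R).
  by apply: measurable_funD.
pose tm : {mfun measurableTypeR R >-> measurableTypeR R} := HB.pack
  (fun x : measurableTypeR R => (x + t)%R : measurableTypeR R)
  (isMeasurableFun.Build _ _ _ _ _ mt).
apply/esym/(@lebesgue_measure_unique _ (pushforward lebesgue_measure tm)) => //= _ [[a b]] _ <-.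
rewrite /pushforward/= (_ : _ @^-1` _ = `](a - t)%R, (b - t)%R]%classic).
  rewrite !lebesgue_measure_itv/= !lte_fin ltrD2r.
  by case: ifPn => // _; rewrite -!EFinD; congr EFin; ring.
by apply/seteqP; split => x /=; rewrite !in_itv/= ltrBlDr lerBrDr.
Qed.

Lemma measurable_laplace_pdf (b : R) (D : set R) : measurable_fun D (laplace_pdf b).
Proof.
apply: measurable_funM => //; apply: measurableT_comp => //.
apply: measurableT_comp => //.
exact: measurable_funM.
Qed.

(** The triangle inequality [|x| <= |x - t| + |t|], placed in the exponent. *)
Lemma laplace_pdf_shift (b t x : R) : (0 < b)%R ->
  (laplace_pdf b (x - t) <= expR (`|t| / b) * laplace_pdf b x)%R.
Proof.
move=> b0; rewrite /laplace_pdf mulrCA ler_pM2l ?invr_gt0 ?mulr_gt0//.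
rewrite -expRD ler_expR -mulrBl -mulNr ler_pM2r ?invr_gt0//.
rewrite lerNl opprB lerBlDl; have := ler_normD (x - t)%R t.
by rewrite subrK addrC.
Qed.

(** Translation invariance moves the shift from the set to the density, where the pointwise bound
    applies under the integral. *)
Lemma laplace_prob_shift (b t : R) (A : set R) : (0 < b)%R -> measurable A ->
  laplace_prob b ((fun x => (x + t)%R) @^-1` A) <=
  (expR (`|t| / b))%:E * laplace_prob b A.
Proof.
move=> b0 mA; rewrite /laplace_prob gt_eqF//.
have pdf0 x : (0 <= laplace_pdf b x)%R.
  by rewrite mulr_ge0 ?expR_ge0// invr_ge0 mulr_ge0// ltW.
have mt u : measurable_fun setT (fun x : measurableTypeR R => (x + u)%R : measurableTypeR R).
  by apply: measurable_funD.
rewrite -ge0_integralZl_EFin ?expR_ge0//; last 2 first.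
  by move=> x _; rewrite lee_fin.
  by apply/measurable_EFinP; exact: measurable_laplace_pdf.
rewrite (_ : \int[_]_(x in _ @^-1` _) _ =
    \int[lebesgue_measure]_(x in A) (laplace_pdf b (x - t))%:E); last first.
  transitivity (\int[pushforward lebesgue_measure
      (fun x : measurableTypeR R => (x + t)%R : measurableTypeR R)]_(x in A)
      (laplace_pdf b (x - t))%:E).
    rewrite ge0_integral_pushforward//=.
    - by apply: eq_integral => x _ /=; rewrite addrK.
    - apply/measurable_EFinP.
      apply: (measurableT_comp (measurable_laplace_pdf b setT)).
      exact: measurable_funS (mt (- t)%R).
    - by move=> x _; rewrite lee_fin.
  apply: eq_measure_integral => /= B mB _.
  exact: lebesgue_measure_shift.
apply: ge0_le_integral => //.
- by move=> x _; rewrite lee_fin.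
- apply/measurable_EFinP.
  apply: (measurableT_comp (measurable_laplace_pdf b setT)).
  exact: measurable_funS (mt (- t)%R).
- by apply/measurable_EFinP/measurable_funM => //; exact: measurable_laplace_pdf.
- by move=> x _; rewrite lee_fin; exact: laplace_pdf_shift.
Qed.

End laplace_shift.

(** * Shifts of product laws, one coordinate at a time *)

Section product_shift.
Context {R : realType} {k : nat}.
Local Open Scope ereal_scope.
Implicit Types (y v : k.-tuple R) (i : 'I_k) (S : set (k.-tuple R)).

Definition set_coord i (p : k.-tuple R * R) : k.-tuple R :=
  [tuple if j == i then p.2 else tnth p.1 j | j < k].

Definition tuple_add v y : k.-tuple R := [tuple (tnth v i + tnth y i)%R | i < k].

Lemma measurable_set_coord i : measurable_fun setT (set_coord i).
Proof.
apply/measurable_fun_tnthP => j.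
have [->|ji] := eqVneq j i.
  rewrite (_ : _ \o _ = snd)//; apply/funext => p /=.
  by rewrite tnth_mktuple eqxx.
rewrite (_ : _ \o _ = (fun y => tnth y j) \o fst); last first.
  by apply/funext => p /=; rewrite tnth_mktuple (negbTE ji).
by apply: measurableT_comp => //; exact: measurable_tnth.
Qed.

Lemma measurable_tuple_add v : measurable_fun setT (tuple_add v).
Proof.
apply/measurable_fun_tnthP => j.
rewrite (_ : _ \o _ = fun y => (tnth v j + tnth y j)%R); last first.
  by apply/funext => y /=; rewrite tnth_mktuple.
by apply: measurable_funD => //; exact: measurable_tnth.
Qed.

Variables (nu : probability (k.-tuple R) R)
  (m : 'I_k -> probability (R) R).
Hypothesis nu_box : forall a,
  nu (upper_box a) = \prod_(i < k) m i (upper_ray (a i)).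

(* Redrawing coordinate [i] independently does not change a product law; this
   reduces a shift of that coordinate to a shift on the real line. *)
Lemma resample_coord i S : measurable S ->
  nu S = (nu \x m i) (set_coord i @^-1` S).
Proof.
pose phi : {mfun (k.-tuple R * R)%type >-> k.-tuple R} := HB.pack (set_coord i)
  (isMeasurableFun.Build _ _ _ _ _ (measurable_set_coord i)).
apply: (@upper_box_unique _ _ nu (pushforward (nu \x m i) phi)).
  by rewrite [ltLHS](probability_setT nu) ltry.
move=> a; rewrite /= /pushforward.
(* The old value of coordinate [i] is overwritten, hence unconstrained: its factor is
   [m i setT = 1], and the fresh draw supplies the missing one. *)
rewrite (_ : _ @^-1` _ =
    upper_box (fun j => if j == i then -oo else a j) `*` upper_ray (a i)).
  rewrite product_measure1E//=; last 2 first.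
    exact: measurable_upper_box.
    exact: measurable_upper_ray.
  rewrite !nu_box (bigD1 i)//= [in RHS](bigD1 i)//= eqxx upper_rayNy.
  rewrite probability_setT mul1e muleC; congr (_ * _).
  by apply: eq_bigr => j /negbTE ->.
apply/seteqP; split => -[y x]/=.
  move=> h; split => [j|]/=; last first.
    by have := h i; rewrite tnth_mktuple eqxx.
  have := h j; rewrite tnth_mktuple; case: ifP => // _ _.
  by rewrite upper_rayNy.
move=> [h1 h2] j; rewrite tnth_mktuple.
by have := h1 j; case: eqP => [->|].
Qed.

Variable b : R.
Hypothesis m_shift : forall i (t : R) (A : set R), measurable A ->
  m i ((fun x => (x + t)%R) @^-1` A) <= (expR (`|t| / b))%:E * m i A.

(** After resampling coordinate [i], both sides are integrals over the remaining coordinates, and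
    for each fixed value of these only a shift of the line is left. *)
Lemma shift_coord_le i v S : (forall j, j != i -> tnth v j = 0%R) ->
  measurable S ->
  nu (tuple_add v @^-1` S) <= (expR (`|tnth v i| / b))%:E * nu S.
Proof.
move=> v0 mS.
have mX (S' : set (k.-tuple R)) : measurable S' ->
    measurable (set_coord i @^-1` S').
  by move=> mS'; rewrite -[X in measurable X]setTI; exact: measurable_set_coord.
have mvS : measurable (tuple_add v @^-1` S).
  by rewrite -[X in measurable X]setTI; exact: measurable_tuple_add.
rewrite (resample_coord i _ mvS) (resample_coord i _ mS) /product_measure1.
rewrite -ge0_integralZl_EFin ?expR_ge0//; last first.
  exact: measurable_fun_xsection (mX _ mS).
apply: ge0_le_integral => //.
- exact: measurable_fun_xsection (mX _ mvS).
- apply: measurable_funeM; exact: measurable_fun_xsection (mX _ mS).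
move=> y _ /=.
(* Shifting after the redraw amounts to shifting the base tuple and the fresh value [x]
   separately. *)
rewrite (_ : xsection _ y = (fun x => (x + tnth v i)%R) @^-1`
    xsection (set_coord i @^-1` S) (tuple_add v y)); last first.
  apply/seteqP; split => x; rewrite /xsection/= !inE/=;
  rewrite (_ : set_coord i (tuple_add v y, _) =
    tuple_add v (set_coord i (y, x)))//;
  apply: eq_from_tnth => j; rewrite !tnth_mktuple/=;
  by case: eqP => [->|_]; rewrite ?tnth_mktuple// addrC.
apply: le_trans.
  by apply: m_shift; apply: measurable_xsection; exact: mX.
(* [v] changes [y] at coordinate [i] only, and that coordinate is overwritten. *)
rewrite (_ : xsection _ (tuple_add v y) = xsection (set_coord i @^-1` S) y)//.
apply/seteqP; split => x; rewrite /xsection/= !inE/=;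
rewrite (_ : set_coord i (tuple_add v y, x) = set_coord i (y, x))//;
apply: eq_from_tnth => j; rewrite !tnth_mktuple/=;
by case: eqP => // /eqP ji; rewrite ?tnth_mktuple v0// add0r.
Qed.

(** Shifting the coordinates successively multiplies the factors, so their exponents add up to the
    l1-norm of [v] divided by [b]. *)
Lemma tuple_add_le v S : measurable S ->
  nu (tuple_add v @^-1` S) <= (expR ((\sum_(i < k) `|tnth v i|) / b))%:E * nu S.
Proof.
(* [w n] keeps the first [n] coordinates of [v], leading from no shift at [w 0] to [w k = v]. The
   set is generalized because the induction hypothesis is applied to a shifted set. *)
pose w (n : nat) : k.-tuple R :=
  [tuple if (i < n)%N then tnth v i else 0%R | i < k].
suff h n S' : (n <= k)%N -> measurable S' -> nu (tuple_add (w n) @^-1` S') <=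
    (expR ((\sum_(i < k | (i < n)%N) `|tnth v i|) / b))%:E * nu S'.
  move=> mS; have := h k S (leqnn k) mS.
  rewrite (_ : w k = v); last first.
    by apply: eq_from_tnth => j; rewrite tnth_mktuple ltn_ord.
  by under eq_bigl do rewrite ltn_ord.
elim: n S' => [|n ih] S' nk mS'.
  rewrite big_pred0// mul0r expR0 mul1e.
  rewrite (_ : tuple_add _ @^-1` _ = S')//.
  by apply/seteqP; split => y /=; rewrite (_ : tuple_add _ y = y)//;
    apply: eq_from_tnth => j; rewrite !tnth_mktuple add0r.
pose i := Ordinal nk.
pose e : k.-tuple R := [tuple if j == i then tnth v i else 0%R | j < k].
(* [w n.+1] splits as [w n] plus [e], which is supported on coordinate [n] alone. *)
have -> : tuple_add (w n.+1) @^-1` S' =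
    tuple_add (w n) @^-1` (tuple_add e @^-1` S').
  apply/seteqP; split => y /=;
  rewrite (_ : tuple_add (w n.+1) y = tuple_add e (tuple_add (w n) y))//;
  apply: eq_from_tnth => j; rewrite !tnth_mktuple/= addrA;
  congr (_ + _)%R; rewrite ltnS leq_eqVlt -[j == i]/(j == n :> nat);
  case: eqP => [jn|]/=; rewrite ?add0r// jn ltnn addr0; congr (tnth v _);
  exact/val_inj.
apply: le_trans (ih _ (ltnW nk) _) _.
  by rewrite -[X in measurable X]setTI; exact: measurable_tuple_add.
have := shift_coord_le i e S' _ mS'.
rewrite tnth_mktuple eqxx => he.
apply: le_trans (lee_wpmul2l _ (he _)) _.
- by rewrite lee_fin expR_ge0.
- by move=> j ji; rewrite tnth_mktuple (negbTE ji).
rewrite muleA -EFinM -expRD -mulrDl.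
rewrite (_ : (_ + _)%R = (\sum_(i < k | (i < n.+1)%N) `|tnth v i|)%R)//.
rewrite [in RHS](bigD1 i)//= addrC; congr (_ + _)%R.
apply: eq_bigl => j; rewrite ltnS -[j == i]/(j == n :> nat).
by rewrite ltn_neqAle andbC.
Qed.

End product_shift.

(** * The l1-distance and the support of a coupling *)

Section coupling_support.
Context {R : realType} {k : nat}.
Implicit Types (x y z : k.-tuple R) (C : probability (k.-tuple R * k.-tuple R)%type R).

Lemma dist1_ge0 x y : 0 <= dist1 x y.
Proof. exact: sumr_ge0. Qed.

Lemma dist1C x y : dist1 x y = dist1 y x.
Proof. by apply: eq_bigr => i _; rewrite distrC. Qed.

Lemma dist1_triangle y x z : dist1 x z <= dist1 x y + dist1 y z.
Proof. by rewrite -big_split; apply: ler_sum => i _; exact: ler_distD. Qed.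

Lemma dist1_tnth x y i : `|tnth x i - tnth y i| <= dist1 x y.
Proof. by rewrite /dist1 (bigD1 i)//= lerDl sumr_ge0. Qed.

Lemma measurable_dist1 d (T : measurableType d) (f g : T -> k.-tuple R) :
  measurable_fun setT f -> measurable_fun setT g ->
  measurable_fun setT (fun t => dist1 (f t) (g t)).
Proof.
move=> mf mg; apply: measurable_sum => i.
apply: measurableT_comp => //.
by apply: measurable_funB; [move/measurable_fun_tnthP : mf|move/measurable_fun_tnthP : mg]; exact.
Qed.

Lemma dense_rat_tuple x (e : R) : 0 < e ->
  exists q : k.-tuple rat, dist1 x (map_tuple ratr q) < e.
Proof.
move=> e0.
(* Dividing by [k.+1] instead of [k] covers [k = 0] and keeps the sum of the [k] errors strictly
   below [e]. *)
have ek : 0 < e / k.+1%:R by rewrite divr_gt0.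
have /choice[q qP] : forall i, exists q : rat,
    `|tnth x i - ratr q| < e / k.+1%:R.
  move=> i; move: (e / _) ek => t t0.
  have [|q] := @rat_in_itvoo R (tnth x i - t) (tnth x i + t); first lra.
  by rewrite in_itv/= => /andP[q1 q2]; exists q; rewrite ltr_norml; lra.
exists [tuple q i | i < k].
apply: (@le_lt_trans _ _ (\sum_(i < k) (e / k.+1%:R))).
  by apply: ler_sum => i _; rewrite tnth_map tnth_mktuple ltW.
rewrite sumr_const card_ord -[ltLHS]mulr_natr mulrAC ltr_pdivrMr//.
by rewrite ltr_pM2l// ltr_nat.
Qed.

Let box (p : k.-tuple R * k.-tuple R) (e : R) : set (k.-tuple R * k.-tuple R) :=
  [set w | dist1 w.1 p.1 < e /\ dist1 w.2 p.2 < e].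

Let measurable_box p e : measurable (box p e).
Proof.
rewrite (_ : box p e = [set w | dist1 w.1 p.1 < e] `&` [set w | dist1 w.2 p.2 < e])//.
by apply: measurableI; rewrite -[X in measurable X]setTI;
  rewrite -[X in _ `&` X]/((fun w => dist1 _ _) @^-1` `]-oo, e[);
  apply: measurable_dist1.
Qed.

(** By separability: a point outside the support has a null neighbourhood, which contains a box
    around that point with rational centre and radius [1 / (n + 1)]. There are only countably many
    such boxes. *)
Lemma coupling_support_full C : C.-negligible (~` coupling_support C).
Proof.
pose I : Type := (k.-tuple rat * k.-tuple rat * nat)%type.
pose b (p : I) := box (map_tuple ratr p.1.1, map_tuple ratr p.1.2) p.2.+1%:R^-1.
(* [N] enumerates the rational boxes, replacing those of nonzero mass by the empty set. *)
pose N j := if unpickle j is Some p then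
  if C (b p) == 0%E then b p else set0 else set0.
apply: (@negligibleS _ _ _ C (\bigcup_j N j)); last first.
  apply: negligible_bigcup => j; rewrite /N; case: unpickle => [p|]; last exact: negligible_set0.
  case: eqP => [Cb0|_]; last exact: negligible_set0.
  by apply/negligibleP => //; exact: measurable_box.
move=> [z z'] /=/existsNP[e] /not_implyP[e0 /negP]; rewrite -leNgt => Ce.
(* The factor 2 pays for two legs of a triangle inequality: from a point of the box to its rational
   centre, and from there to [z] or [z']. *)
have [n ne] : exists n, 2 * n.+1%:R^-1 < e :> R.
  have [n _ nP] := near_infty_natSinv_lt (PosNum (divr_gt0 e0 (ltr0n R 2))).
  by exists n; rewrite mulrC -ltr_pdivlMr//; exact: (nP n (leqnn n)).
have n0 : (0 : R) < n.+1%:R^-1 by rewrite invr_gt0.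
have [q qz] := dense_rat_tuple z _ n0.
have [q' qz'] := dense_rat_tuple z' _ n0.
exists (pickle ((q, q', n) : I)) => //.
rewrite /N pickleK.
suff -> : C (b (q, q', n)) = 0%E by rewrite eqxx; split.
apply/eqP; rewrite -measure_le0; apply: le_trans Ce.
apply: le_measure; rewrite ?inE; [exact: measurable_box|exact: measurable_box|].
move=> [w w'] /= [h h']; split => /=.
  apply: le_lt_trans (dist1_triangle (map_tuple ratr q) w z) (lt_trans _ ne).
  by rewrite (dist1C _ z) mulr_natl mulr2n; exact: ltrD.
apply: le_lt_trans (dist1_triangle (map_tuple ratr q') w' z') (lt_trans _ ne).
  by rewrite (dist1C _ z') mulr_natl mulr2n; exact: ltrD.
Qed.

Lemma coupling_ae_le C (r : R) :
  (ereal_sup [set (dist1 z.1 z.2)%:E | z in coupling_support C] <= r%:E)%E ->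
  {ae C, forall w, dist1 w.1 w.2 <= r}.
Proof.
move=> Cr; apply: negligibleS (coupling_support_full C).
move=> w; apply: contra_not => Cw.
rewrite /= -lee_fin; apply: le_trans Cr; apply: ereal_sup_ubound.
by exists w.
Qed.

End coupling_support.

(** * The law of the noisy output *)

Section mechanism_law.
Context {R : realType} {k : nat} {d : measure_display}
  {Omega : measurableType d} {P : probability Omega R}.
Variables (Y : 'I_k -> {RV P >-> R}) (Z : {RV P >-> k.-tuple R}).
Local Open Scope ereal_scope.

Definition noise_vector (w : Omega) : k.-tuple R := [tuple Y i w | i < k].

Lemma measurable_noise_vector : measurable_fun setT noise_vector.
Proof.
apply/measurable_fun_tnthP => i.
rewrite (_ : _ \o _ = Y i)//; last first.
  by apply/funext => w /=; rewrite tnth_mktuple.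
Qed.

HB.instance Definition _ := isMeasurableFun.Build _ _ _ _ noise_vector
  measurable_noise_vector.

Lemma noise_vector_box (b : R) a : iid_laplace b Y ->
  distribution P noise_vector (upper_box a) =
  \prod_(i < k) distribution P (Y i) (upper_ray (a i)).
Proof.
move=> [_ indep]; rewrite -[RHS]indep; last first.
  by move=> i; exact: measurable_upper_ray.
rewrite /distribution /pushforward; congr (P _).
apply/seteqP; split => w /= h i => [_|]; have := h i; rewrite tnth_mktuple//.
exact.
Qed.

Lemma measurable_tuple_add2 :
  measurable_fun setT (fun p : k.-tuple R * k.-tuple R => tuple_add p.1 p.2).
Proof.
apply/measurable_fun_tnthP => j.
rewrite (_ : _ \o _ = fun p => (tnth p.1 j + tnth p.2 j)%R); last first.
  by apply/funext => y /=; rewrite tnth_mktuple.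
by apply: measurable_funD; apply: (measurableT_comp (measurable_tnth j)).
Qed.

(** Independence makes the joint law of [Z] and the noise agree with the product measure on
    rectangles, hence everywhere; the product measure of a set is the integral of the masses of its
    sections. *)
Lemma add_noise_law S : independent_of Y Z -> measurable S ->
  P (add_noise Z Y @^-1` S) =
  \int[distribution P Z]_z distribution P noise_vector (tuple_add z @^-1` S).
Proof.
move=> indep mS.
pose J w := (Z w, noise_vector w).
have mJ : measurable_fun setT J by exact: measurable_fun_pair.
pose phi : {mfun Omega >-> (k.-tuple R * k.-tuple R)%type} := HB.pack J
  (isMeasurableFun.Build _ _ _ _ _ mJ).
pose X := (fun p : k.-tuple R * k.-tuple R => tuple_add p.1 p.2) @^-1` S.
have mX : measurable X.
  by rewrite -[X in measurable X]setTI; exact: measurable_tuple_add2.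
have := @product_measure_unique _ _ _ _ _ (distribution P Z)
  (distribution P noise_vector) (distribution P phi) _ X mX.
rewrite /product_measure1 /= => h.
transitivity (distribution P phi X).
  rewrite /distribution /pushforward; congr (P _).
  by apply/seteqP; split => w /=; rewrite /X/= (_ : tuple_add _ _ = add_noise Z Y w)//;
    apply: eq_from_tnth => j; rewrite !tnth_mktuple.
rewrite -h.
  by apply: eq_integral => z _ /=; congr (distribution P noise_vector _);
    apply/seteqP; split => y; rewrite /xsection/= inE.
move=> A B mA mB; rewrite muleC -[RHS](indep B A mB mA).
rewrite /distribution /pushforward; congr (P _).
by apply/seteqP; split => w [].
Qed.

End mechanism_law.

(** * Pointwise and box comparisons for nearby vectors *)

Section coupled_laws.
Context {R : realType} {k : nat}.
Local Open Scope ereal_scope.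

Lemma measurable_tuple_add_section (nu : probability (k.-tuple R) R) S :
  measurable S -> measurable_fun setT (fun z => nu (tuple_add z @^-1` S)).
Proof.
move=> mS; pose X := (fun p : k.-tuple R * k.-tuple R => tuple_add p.1 p.2) @^-1` S.
have mX : measurable X.
  by rewrite -[X in measurable X]setTI; exact: measurable_tuple_add2.
rewrite (_ : (fun z => _) = nu \o xsection X); first exact: measurable_fun_xsection.
apply/funext => z /=; congr (nu _).
by apply/seteqP; split => y; rewrite /xsection/= inE.
Qed.

(** Adding [z] is the same as adding [z - z'] and then [z'], so the shift bound applies with a
    vector of l1-norm [dist1 z z']. *)
Lemma tuple_add_dist1_le (nu : probability (k.-tuple R) R) (m : 'I_k -> probability R R)
    (b : R) (z z' : k.-tuple R) S :
  (forall a, nu (upper_box a) = \prod_(i < k) m i (upper_ray (a i))) ->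
  (forall i (t : R) (A : set R), measurable A ->
    m i ((fun x => (x + t)%R) @^-1` A) <= (expR (`|t| / b))%:E * m i A) ->
  measurable S ->
  nu (tuple_add z @^-1` S) <= (expR (dist1 z z' / b))%:E * nu (tuple_add z' @^-1` S).
Proof.
move=> nu_box m_shift mS.
pose v : k.-tuple R := [tuple (tnth z i - tnth z' i)%R | i < k].
rewrite (_ : tuple_add z @^-1` S = tuple_add v @^-1` (tuple_add z' @^-1` S)); last first.
  apply/seteqP; split => y /=; rewrite (_ : tuple_add z' (tuple_add v y) = tuple_add z y)//;
  apply: eq_from_tnth => i; rewrite !tnth_mktuple; ring.
rewrite (_ : dist1 z z' = (\sum_(i < k) `|tnth v i|)%R); last first.
  by apply: eq_bigr => i _; rewrite tnth_mktuple.
apply: tuple_add_le => //.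
by rewrite -[X in measurable X]setTI; exact: measurable_tuple_add.
Qed.

(** A move of l1-size at most [e] lowers no coordinate by more than [e], so lowering every threshold
    by [e] absorbs it. *)
Lemma box_le_near d (T : measurableType d) (C : probability T R)
    (f g : T -> k.-tuple R) (e : R) (a : 'I_k -> \bar R) :
  measurable_fun setT f -> measurable_fun setT g ->
  {ae C, forall w, (dist1 (f w) (g w) <= e)%R} ->
  C (f @^-1` upper_box a) <= C (g @^-1` upper_box (fun i => a i - e%:E)).
Proof.
move=> mf mg [N [mN CN0 Nsub]].
have mpre (h : T -> k.-tuple R) a' : measurable_fun setT h ->
    measurable (h @^-1` upper_box a').
  by move=> mh; rewrite -[X in measurable X]setTI; apply: mh => //; exact: measurable_upper_box.
(* The exceptional set is null, so adjoining it to the right-hand event costs nothing. *)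
rewrite -[leRHS]adde0 -CN0.
apply: le_trans (measureU2 C (mpre g _ mg) mN).
apply: le_measure; rewrite ?inE; [exact: mpre|by apply: measurableU => //; exact: mpre|].
move=> w fw; have [wN|wN] := pselect (N w); [by right|left => i].
have wd : (dist1 (f w) (g w) <= e)%R by apply: contrapT => h; exact/wN/Nsub.
rewrite /upper_ray /mkset leeBlDr//; apply: le_trans (fw i) _.
rewrite -EFinD lee_fin -lerBlDl; apply: le_trans wd.
exact: le_trans (ler_norm _) (dist1_tnth _ _ _).
Qed.

Lemma upper_box_bigcap (a : 'I_k -> \bar R) :
  \bigcap_n upper_box (fun i => a i - n.+1%:R^-1%:E) = upper_box a.
Proof.
apply/seteqP; split => z h i; last first.
  move=> _ j; rewrite /upper_ray /mkset leeBlDr//; apply: le_trans (h j) _.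
  by rewrite leeDl// lee_fin invr_ge0.
rewrite /upper_ray/=; apply/lee_addgt0Pr => e e0.
have [n _ nP] := near_infty_natSinv_lt (PosNum e0).
have /= ne := nP n (leqnn n).
have := h n I i; rewrite /upper_ray /mkset leeBlDr// => /le_trans; apply.
by rewrite leeD2l// lee_fin ltW.
Qed.

(** Continuity of [m2] from above along [e = 1 / (n + 1)]: the enlarged boxes decrease to the
    original one because its rays are closed. *)
Lemma box_le_of_near (m1 m2 : probability (k.-tuple R) R) (a : 'I_k -> \bar R) :
  (forall e : R, (0 < e)%R ->
    m1 (upper_box a) <= m2 (upper_box (fun i => a i - e%:E))) ->
  m1 (upper_box a) <= m2 (upper_box a).
Proof.
move=> m12; pose F n := upper_box (fun i => a i - n.+1%:R^-1%:E).
have F_cvg : m2 \o F @ \oo --> m2 (upper_box a).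
  rewrite -upper_box_bigcap; apply: nonincreasing_cvg_mu => //.
  - by apply: le_lt_trans (probability_le1 _ _) (ltry _); exact: measurable_upper_box.
  - by move=> n; exact: measurable_upper_box.
  - by rewrite upper_box_bigcap; exact: measurable_upper_box.
  - move=> n p np; apply/subsetPset => z h i; apply: le_trans (h i).
    by rewrite leeD2l// leeN2 lee_fin lef_pV2 ?posrE// ler_nat.
rewrite -(cvg_lim _ F_cvg)//; apply: lime_ge; first by apply/cvg_ex; eexists; exact: F_cvg.
by apply: nearW => n; apply: m12.
Qed.

End coupled_laws.

(** * Comparing two mechanisms through a coupling *)

Section mechanism_comparison.
Context {R : realType} {k : nat} {d d' : measure_display}
  {Omega : measurableType d} {Omega' : measurableType d'}
  {P : probability Omega R} {P' : probability Omega' R}.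
Variables (Z : {RV P >-> k.-tuple R}) (Z' : {RV P' >-> k.-tuple R}).
Variables (Y : 'I_k -> {RV P >-> R}) (Y' : 'I_k -> {RV P' >-> R}).
Hypotheses (indep : independent_of Y Z) (indep' : independent_of Y' Z').
Local Open Scope ereal_scope.

Lemma noise_vector_unique (b : R) S : iid_laplace b Y -> iid_laplace b Y' ->
  measurable S ->
  distribution P (noise_vector Y) S = distribution P' (noise_vector Y') S.
Proof.
move=> hY hY'; apply: upper_box_unique.
  by rewrite [ltLHS]probability_setT ltry.
move=> a; rewrite [LHS](noise_vector_box _ _ _ hY) [RHS](noise_vector_box _ _ _ hY').
apply: eq_bigr => i _; rewrite hY.1 ?hY'.1//; exact: measurable_upper_ray.
Qed.

(** Brings integrals over two different laws under the single measure [C], where integrands can be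
    compared pointwise. *)
Lemma integral_coupling C (f : k.-tuple R -> \bar R) (g : k.-tuple R -> \bar R) :
  couplings Z Z' C -> measurable_fun setT f -> (forall z, 0 <= f z) ->
  measurable_fun setT g -> (forall z, 0 <= g z) ->
  \int[distribution P Z]_z f z = \int[C]_w f w.1 /\
  \int[distribution P' Z']_z g z = \int[C]_w g w.2.
Proof.
move=> CZ mf f0 mg g0; split.
  transitivity (\int[pushforward C fst]_z f z).
    by apply: eq_measure_integral => A mA _; rewrite [LHS](esym (CZ A mA).1).
  by rewrite ge0_integral_pushforward.
transitivity (\int[pushforward C snd]_z g z).
  by apply: eq_measure_integral => A mA _; rewrite [LHS](esym (CZ A mA).2).
by rewrite ge0_integral_pushforward.
Qed.

Lemma add_noise_le (b r : R) C S : (0 < b)%R ->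
  iid_laplace b Y -> iid_laplace b Y' -> couplings Z Z' C ->
  {ae C, forall w, (dist1 w.1 w.2 <= r)%R} -> measurable S ->
  P (add_noise Z Y @^-1` S) <= (expR (r / b))%:E * P' (add_noise Z' Y' @^-1` S).
Proof.
move=> b0 hY hY' CZ Cr mS.
rewrite !add_noise_law//.
pose nu := distribution P (noise_vector Y).
pose f z := nu (tuple_add z @^-1` S).
have mf : measurable_fun setT f by exact: measurable_tuple_add_section.
have f0 z : 0 <= f z by exact: measure_ge0.
(* The noise vectors live on different sample spaces but share one law, so the same integrand [f]
   serves on both sides. *)
have -> : \int[distribution P' Z']_z distribution P' (noise_vector Y') (tuple_add z @^-1` S) =
    \int[distribution P' Z']_z f z.
  apply: eq_integral => z _; apply/esym/(noise_vector_unique b) => //.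
  by rewrite -[X in measurable X]setTI; exact: measurable_tuple_add.
have [-> ->] := integral_coupling C f f CZ mf f0 mf f0.
have mf1 : measurable_fun setT (fun w : k.-tuple R * k.-tuple R => f w.1).
  exact: measurableT_comp.
have mf2 : measurable_fun setT (fun w : k.-tuple R * k.-tuple R => f w.2).
  exact: measurableT_comp.
rewrite -ge0_integralZl_EFin ?expR_ge0//.
apply: ae_ge0_le_integral => //.
- by move=> w _; rewrite mule_ge0// lee_fin expR_ge0.
- exact: measurable_funeM.
apply: filterS Cr => w wr _.
apply: le_trans (tuple_add_dist1_le nu (fun i => distribution P (Y i)) b _ w.2 S _ _ mS) _.
- by move=> a; exact: noise_vector_box hY.
- move=> i t A mA.
  have mtA : measurable ((fun x => (x + t)%R) @^-1` A).
    by rewrite -[X in measurable X]setTI; exact: measurable_funD.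
  rewrite [leLHS](hY.1 i _ mtA) [X in _ * X](hY.1 i _ mA).
  exact: laplace_prob_shift.
- by rewrite lee_wpmul2r// lee_fin ler_expR ler_pM2r// invr_gt0.
Qed.

End mechanism_comparison.

(** * The degenerate case of noise scale 0 *)

Lemma laplace0_noise (R : realType) (k : nat) d (Omega : measurableType d)
    (P : probability Omega R) (Y : 'I_k -> {RV P >-> R}) (Z : {RV P >-> k.-tuple R}) S :
  independent_of Y Z -> iid_laplace 0 Y -> measurable S ->
  P (add_noise Z Y @^-1` S) = distribution P Z S.
Proof.
move=> indep hY mS; rewrite add_noise_law//.
pose o : k.-tuple R := [tuple 0 | i < k].
(* On a box, a product of point masses at 0 is 1 exactly when every ray contains 0, that is, when
   [o] lies in the box. *)
have noise0 S' : measurable S' -> distribution P (noise_vector Y) S' = \d_o S'.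
  apply: upper_box_unique; first by rewrite [ltLHS]probability_setT ltry.
  move=> a; rewrite [LHS](noise_vector_box _ _ _ hY) [RHS]diracE.
  have -> : (\prod_(i < k) distribution P (Y i) (upper_ray (a i)) =
      \prod_(i < k) \d_(0%R : R) (upper_ray (a i)))%E.
    apply: eq_bigr => i _; rewrite hY.1 ?/laplace_prob ?eqxx//.
    exact: measurable_upper_ray.
  have [|] := boolP (o \in upper_box a); rewrite ?inE.
    move=> oa; rewrite big1// => i _; rewrite diracE mem_set//.
    by have := oa i; rewrite tnth_mktuple.
  rewrite notin_setE => /existsNP[i]; rewrite tnth_mktuple => ai.
  by rewrite (bigD1 i)//= diracE memNset// mul0e.
rewrite (eq_integral (fun z => (\1_S z)%:E)); last first.
  move=> z _; rewrite noise0.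
    rewrite diracE indicE; congr ((nat_of_bool _)%:R%:E).
    by apply/idP/idP; rewrite !inE/= (_ : tuple_add z o = z)//;
      apply: eq_from_tnth => i; rewrite !tnth_mktuple addr0.
  by rewrite -[X in measurable X]setTI; exact: measurable_tuple_add.
by rewrite integral_indic// setIT.
Qed.

(** Each inequality on boxes comes from the same couplings, read in the two directions by symmetry
    of [dist1]. *)
Lemma coupled_laws_eq (R : realType) (k : nat) (d d' : measure_display)
    (Omega : measurableType d) (Omega' : measurableType d')
    (P : probability Omega R) (P' : probability Omega' R)
    (Z : {RV P >-> k.-tuple R}) (Z' : {RV P' >-> k.-tuple R}) :
  (forall e : R, 0 < e -> exists2 C, couplings Z Z' C &
    {ae C, forall w, dist1 w.1 w.2 <= e}) ->
  forall S, measurable S -> distribution P Z S = distribution P' Z' S.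
Proof.
move=> hC; apply: upper_box_unique.
  by rewrite [ltLHS]probability_setT ltry.
move=> a; apply/eqP; rewrite eq_le; apply/andP; split.
  apply: box_le_of_near => e e0; have [C CZ Ce] := hC _ e0.
  rewrite [leLHS](esym (CZ _ (measurable_upper_box _)).1).
  rewrite [leRHS](esym (CZ _ (measurable_upper_box _)).2).
  exact: box_le_near.
apply: box_le_of_near => e e0; have [C CZ Ce] := hC _ e0.
rewrite [leLHS](esym (CZ _ (measurable_upper_box _)).2).
rewrite [leRHS](esym (CZ _ (measurable_upper_box _)).1).
by apply: box_le_near => //; apply: filterS Ce => w; rewrite dist1C.
Qed.

(** * Near-optimal couplings, the limit in the exponent, and privacy *)

Lemma near_optimal_coupling (R : realType) (k : nat) (Data : Type)
    (nbr : Data -> Data -> Prop)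
    (d : Data -> measure_display) (Omega : forall D : Data, measurableType (d D))
    (P : forall D : Data, probability (Omega D) R)
    (A : forall D : Data, {RV (P D) >-> k.-tuple R}) (D1 D2 : Data) (r : R) :
  nbr D1 D2 -> (coupled_global_sensitivity nbr A < r%:E)%E ->
  exists2 C, couplings (A D1) (A D2) C & {ae C, forall w, dist1 w.1 w.2 <= r}.
Proof.
move=> D12 Ar.
have : (ereal_inf [set ereal_sup [set (dist1 z.1 z.2)%:E | z in coupling_support C]
    | C in couplings (A D1) (A D2)] < r%:E)%E.
  by apply: le_lt_trans Ar; apply: ereal_sup_ubound; exists D1, D2.
move=> /ereal_inf_lt[_ [C CA <-] Cr]; exists C => //.
by apply: coupling_ae_le; exact: ltW.
Qed.

(** For negative [r] the exceptional null set would be the whole space, which has mass 1. This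
    yields nonnegativity of the sensitivity. *)
Lemma ae_dist1_le_ge0 (R : realType) (k : nat)
    (C : probability (k.-tuple R * k.-tuple R)%type R) (r : R) :
  {ae C, forall w, dist1 w.1 w.2 <= r} -> 0 <= r.
Proof.
move=> [N [mN CN0 Nsub]]; rewrite leNgt; apply/negP => r0.
have NT : N = setT.
  apply/seteqP; split => // w _; apply: Nsub => /= wr.
  by have := dist1_ge0 w.1 w.2; rewrite leNgt (le_lt_trans wr).
by move: CN0; rewrite NT [LHS]probability_setT => /eqP; rewrite onee_eq0.
Qed.

Lemma le_expRM_of_near (R : realType) (x y : \bar R) (e : R) :
  (0 <= x)%E -> (x < +oo)%E -> (0 <= y)%E -> (y < +oo)%E ->
  (forall h : R, 0 < h -> (x <= (expR (e + h))%:E * y)%E) ->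
  (x <= (expR e)%:E * y)%E.
Proof.
case: x => // x; case: y => // y _ _; rewrite lee_fin => y0 _ xy.
rewrite -EFinM lee_fin leNgt; apply/negP => yx.
have x0 : 0 < x by apply: le_lt_trans yx; rewrite mulr_ge0// expR_ge0.
have [y00|yn0] := eqVneq y 0.
  by have := xy 1 ltr01; rewrite y00 -EFinM mulr0 lee_fin leNgt x0.
have ypos : 0 < expR e * y by rewrite mulr_gt0 ?expR_gt0// lt0r yn0.
pose q := x / (expR e * y).
have q1 : 1 < q by rewrite ltr_pdivlMr// mul1r.
have lq : 0 < ln q by rewrite ln_gt0.
(* With [h = ln q / 2] the hypothesis bounds [x] by [sqrt q * expR e * y], which is less than
   [q * expR e * y = x] since [q > 1]. *)
have := xy (ln q / 2) (divr_gt0 lq (ltr0Sn _ 1)).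
rewrite -EFinM lee_fin expRD mulrAC.
apply/negP; rewrite -ltNge mulrC -ltr_pdivlMr// -[ltRHS]lnK ?ltr_expR ?posrE ?(lt_trans _ q1)//.
by rewrite gtr_pMr// invf_lt1// ltr1n.
Qed.

Theorem theorem4 (R : realType) (k : nat) (Data : Type)
    (nbr : Data -> Data -> Prop)
    (d : Data -> measure_display) (Omega : forall D : Data, measurableType (d D))
    (P : forall D : Data, probability (Omega D) R)
    (A : forall D : Data, {RV (P D) >-> k.-tuple R})
    (eps : R) (heps : 0 < eps)
    (hCGS : (coupled_global_sensitivity nbr A < +oo)%E)
    (Y : forall D : Data, 'I_k -> {RV (P D) >-> R})
    (hY : forall D : Data,
      iid_laplace (fine (coupled_global_sensitivity nbr A) / eps) (Y D))
    (hYA : forall D : Data, independent_of (Y D) (A D)) :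
  differentially_private nbr eps P (fun D : Data => add_noise (A D) (Y D)).
Proof.
move=> D1 D2 D12 S mS.
set s := fine (coupled_global_sensitivity nbr A) in hY *.
have coup (e : R) : 0 < e -> exists2 C, couplings (A D1) (A D2) C &
    {ae C, forall w, dist1 w.1 w.2 <= s + e}.
  move=> e0; apply: (near_optimal_coupling _ _ _ nbr) => //; rewrite /s.
  (* Finiteness excludes [+oo]; at [-oo], where [fine] returns 0, the strict bound is immediate. *)
  move: hCGS; case: (coupled_global_sensitivity nbr A) => [r| |]//= _.
    by rewrite lte_fin ltrDl.
  exact: ltNyr.
have s0 : 0 <= s.
  by apply/ler_addgt0Pr => e /coup[C _ /ae_dist1_le_ge0].
have [s00|sn0] := eqVneq s 0.
  have hY0 D : iid_laplace 0 (Y D) by have := hY D; rewrite s00 mul0r.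
  (* Both outputs have the same law here, and [expR eps] is at least 1. *)
  rewrite !laplace0_noise// (coupled_laws_eq _ _ _ _ _ _ _ _ (A D1) (A D2) _ _ mS).
    by rewrite lee_pemull// lee_fin ltW// expR_gt1.
  by move=> e /coup; rewrite s00 add0r.
have spos : 0 < s by rewrite lt0r sn0.
have mM D : measurable (add_noise (A D) (Y D) @^-1` S).
  rewrite -[X in measurable X]setTI.
  suff : measurable_fun setT (add_noise (A D) (Y D)) by apply.
  have -> : add_noise (A D) (Y D) = (fun p => tuple_add p.1 p.2) \o
      (fun w => (A D w, noise_vector (Y D) w)).
    by apply/funext => w; apply: eq_from_tnth => i; rewrite !tnth_mktuple.
  apply: measurableT_comp; first exact: measurable_tuple_add2.
  by apply: measurable_fun_pair => //; exact: measurable_noise_vector.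
have fin D : (P D (add_noise (A D) (Y D) @^-1` S) < +oo)%E.
  exact: le_lt_trans (probability_le1 _ (mM D)) (ltry _).
apply: le_expRM_of_near => // h h0.
(* The slack is chosen so that dividing [s + s * h / eps] by the noise scale [s / eps] gives exactly
   [eps + h]. *)
have [|C CA Cr] := coup (s * h / eps).
  by rewrite divr_gt0// mulr_gt0.
have := add_noise_le _ _ _ _ (hYA D1) (hYA D2) _ _ _ _ (divr_gt0 spos heps) (hY D1) (hY D2) CA Cr mS.
rewrite (_ : (s + s * h / eps) / (s / eps) = eps + h)//.
by field; rewrite sn0 gt_eqF.
Qed.
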